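(* Let $n,k$ be integers with $1\le k\le \lfloor n/2\rfloor$. Any standard quantum circuit on $n$ qubits (no ancillary qubits, no measurements) generating, from $|0\rangle^{\otimes n}$, the $(n,k)$-Dicke state $$|D^n_k\rangle=\frac{1}{\sqrt{\binom{n}{k}}}\sum_{x\in\{0,1\}^n:\,|x|=k}|x\rangle$$ needs depth at least 1. $\Omega(\log(n))$ with all-to-all qubit connectivity; 2. $\Omega(n_2)$ under the $(n_1\times n_2)$-grid constraint, where $n_1\le n_2$ are positive integers with $n=n_1n_2$; 3. $\Omega(n)$ under the $n$-vertex path constraint.
   Context: For $x\in\{0,1\}^n$, $|x|$ denotes the Hamming weight of $x$. A standard quantum circuit is a circuit composed only of 1-qubit and 2-qubit unitary gates; its depth is the number of layers, where each layer consists of gates acting on pairwise disjoint sets of qubits. Given a graph $G=(V,E)$ whose vertices are the qubits, a circuit is under $G$ constraint if every two-qubit gate acts on a pair of qubits $i,j$ with $(i,j)\in E$. All-to-all connectivity: $G$ is the complete graph on $n$ vertices. $(n_1\times n_2)$-grid constraint: $G$ is the two-dimensional grid graph with $n_1$ rows and $n_2$ columns (edges between horizontally or vertically neighbouring vertices). Path constraint: $G$ is the path on $n$ vertices. The constants hidden in $\Omega(\cdot)$ are absolute (independent of $n,n_1,n_2,k$). *)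

(* Defs.v *)
From HB Require Import structures.
From mathcomp Require Import all_boot all_order all_algebra spectral.
From mathcomp Require Import complex.
From mathcomp Require Import reals exp.

Set Implicit Arguments.
Unset Strict Implicit.
Unset Printing Implicit Defensive.

Import GRing.Theory Num.Theory.
Local Open Scope ring_scope.

Record sgraph (V : finType) := SGraph {
  edge : rel V;
  edge_sym : symmetric edge;
  edge_irr : irreflexive edge
}.

Section Graphs.

Fact complete_sym (V : finType) : symmetric (fun u v : V => u != v).
Proof. by move=> u v; rewrite eq_sym. Qed.

Fact complete_irr (V : finType) : irreflexive (fun u v : V => u != v).
Proof. by move=> u; rewrite eqxx. Qed.

Definition complete_graph (V : finType) : sgraph V :=
  SGraph (@complete_sym V) (@complete_irr V).

Definition adjacent_ord n (i j : 'I_n) : bool :=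
  (i.+1 == j :> nat) || (j.+1 == i :> nat).

Fact adjacent_ord_sym n : symmetric (@adjacent_ord n).
Proof. by move=> i j; rewrite /adjacent_ord orbC. Qed.

Fact adjacent_ord_irr n : irreflexive (@adjacent_ord n).
Proof. by move=> i; rewrite /adjacent_ord orbb eqn_leq ltnn. Qed.

Definition path_graph (n : nat) : sgraph 'I_n :=
  SGraph (@adjacent_ord_sym n) (@adjacent_ord_irr n).

Definition grid_edge n1 n2 (u v : 'I_n1 * 'I_n2) : bool :=
  ((u.1 == v.1) && adjacent_ord u.2 v.2)
  || ((u.2 == v.2) && adjacent_ord u.1 v.1).

Fact grid_edge_sym n1 n2 : symmetric (@grid_edge n1 n2).
Proof.
move=> u v; rewrite /grid_edge (eq_sym u.1) (eq_sym u.2).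
by rewrite (adjacent_ord_sym u.1) (adjacent_ord_sym u.2).
Qed.

Fact grid_edge_irr n1 n2 : irreflexive (@grid_edge n1 n2).
Proof. by move=> u; rewrite /grid_edge !adjacent_ord_irr !andbF. Qed.

Definition grid_graph (n1 n2 : nat) : sgraph ('I_n1 * 'I_n2)%type :=
  SGraph (@grid_edge_sym n1 n2) (@grid_edge_irr n1 n2).

End Graphs.

(* The qubits are labelled by a finite type V; a bit string is a map V -> {0,1},
   with {0,1} taken to be 'I_2 so that bits index the rows and columns of gate
   matrices directly. *)
Definition bitstring (V : finType) := {ffun V -> 'I_2}.

Definition hweight (V : finType) (x : bitstring V) : nat := \sum_v x v.

(* The space of n-qubit vectors, by amplitudes in the computational basis.
   The regular module C^o gives the pointwise sum and scaling. *)
Definition qvect (R : realType) (V : finType) := {ffun bitstring V -> R[i]^o}.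

Definition ket (R : realType) (V : finType) (x : bitstring V) : qvect R V :=
  [ffun y => (y == x)%:R].

Definition ket0 (R : realType) (V : finType) : qvect R V :=
  ket R [ffun _ : V => ord0].

Definition dicke (R : realType) (V : finType) (k : nat) : qvect R V :=
  (sqrtC ('C(#|V|, k)%:R : R[i]))^-1 *:
    \sum_(x : bitstring V | hweight x == k) ket R x.

(* In Gate2 i j U, the basis of the two-qubit space is indexed by
   mxvec_index a b, that is 2a + b, with a the bit of i and b the bit of j. *)
Inductive gate (R : realType) (V : finType) :=
| Gate1 (i : V) (U : 'M[R[i]]_2) of U \is unitarymx
| Gate2 (i j : V) (U : 'M[R[i]]_(2 * 2)) of i != j & U \is unitarymx.

Definition gate_supp (R : realType) (V : finType) (g : gate R V) : {set V} :=
  match g with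
  | Gate1 i _ _ => [set i]
  | Gate2 i j _ _ _ => [set i; j]
  end.

Definition set_bit (V : finType) (i : V) (a : 'I_2) (x : bitstring V) :
    bitstring V :=
  [ffun v => if v == i then a else x v].

(* U acting on the qubit(s) in its support, tensored with the identity on the
   other qubits. *)
Definition apply_gate (R : realType) (V : finType)
    (g : gate R V) (psi : qvect R V) : qvect R V :=
  match g with
  | Gate1 i U _ =>
      [ffun x : bitstring V => \sum_(a < 2) U (x i) a * psi (set_bit i a x)]
  | Gate2 i j U _ _ =>
      [ffun x : bitstring V => \sum_(a < 2) \sum_(b < 2)
         U (mxvec_index (x i) (x j)) (mxvec_index a b)
         * psi (set_bit i a (set_bit j b x))]
  end.

Record layer (R : realType) (V : finType) := Layer {
  layer_gates : seq (gate R V);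
  layer_disjoint :
    pairwise (fun g h => [disjoint gate_supp g & gate_supp h]) layer_gates
}.

(* Gates of a layer commute, so their order in the sequence is immaterial. *)
Definition apply_layer (R : realType) (V : finType)
    (psi : qvect R V) (L : layer R V) : qvect R V :=
  foldl (fun phi g => apply_gate g phi) psi (layer_gates L).

(* The first layer of the sequence is applied first. *)
Definition circuit (R : realType) (V : finType) := seq (layer R V).

Definition run (R : realType) (V : finType)
    (C : circuit R V) (psi : qvect R V) : qvect R V :=
  foldl (@apply_layer R V) psi C.

Definition depth (R : realType) (V : finType) (C : circuit R V) : nat := size C.

Definition gate_respects (R : realType) (V : finType)
    (G : sgraph V) (g : gate R V) : bool :=
  match g with
  | Gate1 _ _ _ => true
  | Gate2 i j _ _ _ => edge G i j
  end.

Definition under_constraint (R : realType) (V : finType)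
    (G : sgraph V) (C : circuit R V) : bool :=
  all (fun L => all (gate_respects G) (layer_gates L)) C.

Definition generates_dicke (R : realType) (V : finType)
    (C : circuit R V) (k : nat) : Prop :=
  run C (ket0 R V) = dicke R V k.

(* Main.v *)
Require Import Defs.
From HB Require Import structures.
From mathcomp Require Import all_boot all_order all_algebra spectral.
From mathcomp Require Import complex.
From mathcomp Require Import reals exp.
From mathcomp Require Import perm zify ring.

(** Pull a one-qubit observable back through the circuit: it becomes an operator
    acting only on the backward light cone of the qubit. If the light cones of two
    qubits i and j are disjoint, then, the input state being a product state, the
    output bits x_i and x_j are uncorrelated. In the Dicke state with 0 < k < n
    all pairs of bits are correlated, since P(x_i = 1) = k/n whereas
    P(x_i = x_j = 1) = k(k-1)/(n(n-1)) <> (k/n)^2. So at depth d all light cones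
    meet pairwise. A light cone spreads by at most one edge per layer, whence
    dist(i, j) <= 2d; and a layer at most doubles it, forwards and backwards,
    whence n <= 4^d. *)

Set Implicit Arguments.
Unset Strict Implicit.
Unset Printing Implicit Defensive.

Import GRing.Theory Num.Theory.
Local Open Scope ring_scope.

(** * Combinatorics of light cones in layers of disjoint supports *)

Section LightCones.

Variable V : finType.
Implicit Types (u v : V) (S T : {set V}) (ss : seq {set V}).
Implicit Types (B : seq (seq {set V})).

Definition disjoint_sets S T := [disjoint S & T].

(* A layer is represented here by the sequence of the supports of its gates. *)
Definition linked ss : rel V :=
  fun u v => (u == v) || has (fun T => (u \in T) && (v \in T)) ss.

Definition nbhd ss S : {set V} := [set u | [exists v in S, linked ss u v]].

(** The support of an observable on [S] pulled back one gate at a time, last gate first: a gate that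
    misses the current support commutes with the observable and cancels against its adjoint, and any
    other gate is absorbed. *)
Definition gate_cone ss S : {set V} :=
  foldr (fun T S' => if [disjoint T & S'] then S' else T :|: S') S ss.

Definition backward_cone B S : {set V} := foldr nbhd S B.

Definition forward_cone B S : {set V} := foldl (fun S' ss => nbhd ss S') S B.

Lemma linked_sym ss u v : linked ss u v = linked ss v u.
Proof.
by rewrite /linked eq_sym; congr orb; apply: eq_has => T; rewrite andbC.
Qed.

Lemma disjointPn S T :
  reflect (exists2 v, v \in S & v \in T) (~~ [disjoint S & T]).
Proof.
apply: (iffP idP) => [/pred0Pn[v /andP[]]|[v Sv Tv]]; first by exists v.
by apply/pred0Pn; exists v; rewrite /= Sv.
Qed.

(** By symmetry of [linked], [nbhd ss] is self-adjoint for the relation of meeting; iterated over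
    the layers, this makes forward and backward cones adjoint to each other. *)
Lemma nbhd_disjoint ss S T : [disjoint nbhd ss S & T] = [disjoint S & nbhd ss T].
Proof.
apply: negb_inj; apply/disjointPn/disjointPn=> [[u]|[v Sv]].
  rewrite inE => /existsP[v /andP[Sv uv]] Tu; exists v => //.
  by rewrite inE; apply/existsP; exists u; rewrite Tu linked_sym.
rewrite inE => /existsP[u /andP[Tu vu]]; exists u => //.
by rewrite inE; apply/existsP; exists v; rewrite Sv linked_sym.
Qed.

Lemma subset_nbhd ss S : S \subset nbhd ss S.
Proof.
apply/subsetP=> v Sv; rewrite inE; apply/existsP; exists v.
by rewrite Sv /linked eqxx.
Qed.

Lemma mem_backward_cone B i : i \in backward_cone B [set i].
Proof.
by elim: B => /= [|ss B]; [rewrite set11 | apply/subsetP/subset_nbhd].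
Qed.

Lemma forward_cone_disjoint B S T :
  [disjoint forward_cone B S & T] = [disjoint S & backward_cone B T].
Proof. by elim: B S => //= ss B IH S; rewrite IH nbhd_disjoint. Qed.

Lemma gate_coneS ss S T : S \subset T -> gate_cone ss S \subset gate_cone ss T.
Proof.
move=> ST; elim: ss => //= A ss IH.
have [dT|mT] := boolP [disjoint A & gate_cone ss T].
  by rewrite (disjointWr IH dT).
case: ifP => _; last exact: setUS.
by rewrite (subset_trans IH) ?subsetUr.
Qed.

Lemma gate_cone_cat ss1 ss2 S :
  gate_cone (ss1 ++ ss2) S = gate_cone ss1 (gate_cone ss2 S).
Proof. exact: foldr_cat. Qed.

(** Gates of one layer cannot chain: a gate [A] that meets the cone of the others does so at a point
    outside all their supports, hence at a point of [S] itself. *)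
Lemma gate_cone_nbhd ss S :
  pairwise disjoint_sets ss -> gate_cone ss S \subset nbhd ss S.
Proof.
elim: ss => [_|A ss IH /= /andP[dA /IH{}IH]]; first exact: subset_nbhd.
have sub : nbhd ss S \subset nbhd (A :: ss) S.
  apply/subsetP=> u; rewrite !inE => /existsP[v /andP[Sv uv]].
  apply/existsP; exists v; rewrite Sv /linked /=.
  by move: uv; rewrite /linked => /orP[->|->]; rewrite ?orbT.
case: ifP => [_|/negbT/disjointPn[u Au cu]]; first exact: subset_trans IH sub.
rewrite subUset (subset_trans IH sub) andbT.
have := subsetP IH u cu; rewrite inE => /existsP[v /andP[Sv]].
rewrite /linked => /orP[/eqP uv|/hasP[T Tss /andP[Tu _]]]; last first.
  by have /disjointFr/(_ Au) := allP dA T Tss; rewrite Tu.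
apply/subsetP=> w Aw; rewrite inE; apply/existsP; exists v.
by rewrite Sv /linked /= Aw -uv Au orbT.
Qed.

Lemma gate_cone_backward B S :
  all (pairwise disjoint_sets) B -> gate_cone (flatten B) S \subset backward_cone B S.
Proof.
elim: B => //= ss B IH /andP[dss /IH{}IH]; rewrite gate_cone_cat.
exact: subset_trans (gate_coneS _ IH) (gate_cone_nbhd _ dss).
Qed.

(** At most one support of the layer contains [v], and that one has at most two elements. *)
Lemma card_linked ss v : pairwise disjoint_sets ss -> all (fun T => #|T| <= 2)%N ss ->
  (#|[set u | linked ss u v]| <= 2)%N.
Proof.
move=> dss css; have [/hasP[T Tss Tv]|nov] := boolP (has (fun T => v \in T) ss).
  apply: leq_trans (allP css T Tss); apply: subset_leq_card; apply/subsetP => u.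
  rewrite inE /linked => /orP[/eqP->//|/hasP[T' T'ss /andP[T'u T'v]]].
  suff -> : T = T' by [].
  elim: ss dss Tss T'ss {css} => //= A ss IH /andP[dA dss].
  rewrite !inE => /predU1P[eT|Tss] /predU1P[eT'|T'ss]; last exact: IH.
  - by rewrite eT.
  - by have /disjointFl/(_ T'v) := allP dA T' T'ss; rewrite -eT Tv.
  - by have /disjointFl/(_ Tv) := allP dA T Tss; rewrite -eT' T'v.
rewrite (@eq_card _ _ (pred1 v)) ?card1 // => u; rewrite inE /linked.
rewrite inE; case: eqP => //= _; apply/negbTE; apply: contra nov.
by apply: sub_has => T /andP[].
Qed.

Lemma card_nbhd ss S : pairwise disjoint_sets ss -> all (fun T => #|T| <= 2)%N ss ->
  (#|nbhd ss S| <= 2 * #|S|)%N.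
Proof.
move=> dss css; have -> : nbhd ss S = \bigcup_(v in S) [set u | linked ss u v].
  apply/setP=> u; rewrite inE; apply/existsP/bigcupP => [[v /andP[Sv uv]]|[v Sv]].
    by exists v; rewrite ?inE.
  by rewrite inE => uv; exists v; rewrite Sv.
rewrite mulnC -sum_nat_const.
elim/big_rec2: _ => [|v n T _ IH]; first by rewrite cards0.
by rewrite (leq_trans (leq_card_setU _ _)) // leq_add ?card_linked.
Qed.

Definition two_local_layer ss :=
  pairwise disjoint_sets ss && all (fun T => #|T| <= 2)%N ss.

Lemma card_backward_cone B S : all two_local_layer B ->
  (#|backward_cone B S| <= 2 ^ size B * #|S|)%N.
Proof.
elim: B => [|ss B IH] /=; first by rewrite mul1n.
move=> /andP[/andP[dss css] /IH{}IH]; rewrite expnS -mulnA.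
by rewrite (leq_trans (card_nbhd _ dss css)) // leq_mul2l.
Qed.

Lemma card_forward_cone B S : all two_local_layer B ->
  (#|forward_cone B S| <= 2 ^ size B * #|S|)%N.
Proof.
elim: B S => [|ss B IH] S /=; first by rewrite mul1n.
move=> /andP[/andP[dss css] /IH{}IH]; rewrite (leq_trans (IH _)) //.
by rewrite expnSr -mulnA leq_mul2l card_nbhd ?orbT.
Qed.

(** By adjointness, every [j] whose backward cone meets that of [i] lies in the forward cone of the
    backward cone of [i]; each of the two passes multiplies the size by at most [2 ^ size B]. *)
Lemma card_meeting_cones B i : all two_local_layer B ->
  (forall j, j != i -> ~~ [disjoint backward_cone B [set i] & backward_cone B [set j]]) ->
  (#|V| <= 4 ^ size B)%N.
Proof.
move=> lB meet; pose T := forward_cone B (backward_cone B [set i]).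
have allT j : j \in T.
  rewrite -[j \in T]negbK -disjoints1 disjoint_sym forward_cone_disjoint.
  have [->|/meet//] := eqVneq j i.
  by apply/disjointPn; exists i; rewrite mem_backward_cone.
have -> : #|V| = #|T| by apply: eq_card => j; rewrite allT.
rewrite (leq_trans (card_forward_cone _ lB)) //.
rewrite (_ : 4 = 2 * 2)%N // expnMn leq_mul2l.
by rewrite (leq_trans (card_backward_cone _ lB)) ?cards1 ?muln1 ?orbT.
Qed.

(** A potential [phi] varying by at most 1 on each support replaces graph distance: every layer
    changes it by at most 1. The condition on a support runs over ordered pairs, so it bounds the
    variation in both directions. *)
Lemma backward_cone_dist (phi : V -> nat) B S u :
  all (all (fun T : {set V} =>
    [forall v in T, [forall w in T, phi v <= (phi w).+1]]))%N B ->
  u \in backward_cone B S ->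
  exists2 v, v \in S & (phi u <= phi v + size B)%N /\ (phi v <= phi u + size B)%N.
Proof.
elim: B u => [|ss B IH] u /=; first by exists u; rewrite ?addn0.
move=> /andP[phi_ss phiB]; rewrite inE => /existsP[w /andP[/(IH _ phiB)[v Sv [wv vw]]]].
rewrite /linked => /orP[/eqP->|/hasP[T Tss /andP[Tu Tw]]].
  by exists v => //; lia.
have phiT := allP phi_ss T Tss; exists v => //.
have le2 x y : x \in T -> y \in T -> (phi x <= (phi y).+1)%N.
  by move=> Tx Ty; have /forall_inP/(_ x Tx)/forall_inP/(_ y Ty) := phiT.
have := le2 _ _ Tu Tw; have := le2 _ _ Tw Tu; lia.
Qed.

Lemma meeting_cones_dist (phi : V -> nat) B i j :
  all (all (fun T : {set V} =>
    [forall v in T, [forall w in T, phi v <= (phi w).+1]]))%N B ->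
  ~~ [disjoint backward_cone B [set i] & backward_cone B [set j]] ->
  (phi j <= phi i + (size B).*2)%N.
Proof.
move=> phiB /disjointPn[u /(backward_cone_dist phiB)[_ /set1P-> [ui iu]]].
by move=> /(backward_cone_dist phiB)[_ /set1P-> [uj ju]]; lia.
Qed.

End LightCones.

(** * Gates as local read and write operations, and their adjoints *)

Section Circuits.

Variables (R : realType) (V : finType).
Implicit Types (x y : bitstring V) (f psi : qvect R V) (g h : gate R V).
Implicit Types (gs : seq (gate R V)) (C : circuit R V).

Local Notation K := R[i].

(** One index type per gate, with [gate_read], [gate_write] and [gate_entry], lets one- and
    two-qubit gates share all later arguments. *)
Definition gate_index g : finType :=
  match g with Gate1 _ _ _ => 'I_2 | Gate2 _ _ _ _ _ => ('I_2 * 'I_2)%type end.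

Definition gate_read g : bitstring V -> gate_index g :=
  match g with
  | Gate1 i _ _ => fun x => x i
  | Gate2 i j _ _ _ => fun x => (x i, x j)
  end.

Definition gate_write g : gate_index g -> bitstring V -> bitstring V :=
  match g with
  | Gate1 i _ _ => set_bit i
  | Gate2 i j _ _ _ => fun t x => set_bit i t.1 (set_bit j t.2 x)
  end.

Definition gate_entry g : gate_index g -> gate_index g -> K :=
  match g with
  | Gate1 _ U _ => fun s t => U s t
  | Gate2 _ _ U _ _ => fun s t => U (mxvec_index s.1 s.2) (mxvec_index t.1 t.2)
  end.

Lemma apply_gateE g psi x :
  apply_gate g psi x =
  \sum_t gate_entry (gate_read g x) t * (psi (gate_write t x) : K).
Proof. by case: g => [i U uU|i j U ij uU]; rewrite ffunE //= pair_big. Qed.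

Lemma gate_writeK g t x : gate_read g (gate_write t x) = t.
Proof.
case: g t => [i U uU|i j U ij uU] t /=; first by rewrite ffunE eqxx.
by rewrite !ffunE !eqxx eq_sym (negPf ij) -surjective_pairing.
Qed.

Lemma gate_readK g x : gate_write (gate_read g x) x = x.
Proof.
by case: g => *; apply/ffunP=> v; rewrite !ffunE /=; do 2?[case: eqP => [->|] //].
Qed.

Lemma gate_write_write g (s t : gate_index g) x :
  gate_write s (gate_write t x) = gate_write s x.
Proof.
by case: g s t => *; apply/ffunP=> v; rewrite !ffunE /=; do 2?case: eqP.
Qed.

Lemma gate_write_out g (t : gate_index g) x v :
  v \notin gate_supp g -> gate_write t x v = x v.
Proof.
case: g t => [i U uU|i j U ij uU] t /=; rewrite !inE !ffunE; first by move/negPf->.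
by rewrite negb_or => /andP[/negPf-> /negPf->].
Qed.

Lemma eq_gate_read g x y : {in gate_supp g, x =1 y} -> gate_read g x = gate_read g y.
Proof. by case: g => [i U uU|i j U ij uU] /= xy; rewrite !xy ?inE ?eqxx ?orbT. Qed.

Lemma eq_gate_write g (t : gate_index g) x y :
  {in gate_supp g, gate_write t x =1 gate_write t y}.
Proof.
move=> v; case: g t => [i U uU|i j U ij uU] t /=; rewrite !inE !ffunE; first by move->.
by case/orP=> -> //=; case: ifP.
Qed.

Lemma gate_read_write g h (t : gate_index h) x :
  [disjoint gate_supp g & gate_supp h] -> gate_read g (gate_write t x) = gate_read g x.
Proof.
by move=> dgh; apply: eq_gate_read => v gv; rewrite gate_write_out ?(disjointFr dgh).
Qed.

Lemma gate_writeC g h (s : gate_index g) (t : gate_index h) x :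
  [disjoint gate_supp g & gate_supp h] ->
  gate_write s (gate_write t x) = gate_write t (gate_write s x).
Proof.
move=> dgh; apply/ffunP=> v; have [gv|gv] := boolP (v \in gate_supp g).
  have hv : v \notin gate_supp h by rewrite (disjointFr dgh).
  by rewrite (gate_write_out _ _ hv) (eq_gate_write _ _ x).
rewrite (gate_write_out _ _ gv); have [hv|hv] := boolP (v \in gate_supp h).
  by rewrite (eq_gate_write _ _ (gate_write s x)).
by rewrite !gate_write_out.
Qed.

(** Orthonormality of the rows of [U]; for two qubits the sum over ['I_(2 * 2)] is reindexed by
    pairs through the bijection [mxvec_index]. *)
Lemma gate_entry_unitary g (s t : gate_index g) :
  \sum_r gate_entry s r * (gate_entry t r)^* = (s == t)%:R.
Proof.
case: g s t => [i U uU|i j U ij uU] s t /=; have /unitarymxP/matrixP := uU.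
  by move/(_ s t); rewrite !mxE => <-; apply: eq_bigr => r _; rewrite !mxE.
move/(_ (mxvec_index s.1 s.2) (mxvec_index t.1 t.2)); rewrite !mxE.
rewrite (reindex _ (curry_mxvec_bij _ _)) /= => eU.
transitivity ((mxvec_index s.1 s.2 == mxvec_index t.1 t.2)%:R : K).
  by rewrite -eU; apply: eq_bigr => -[a b] _; rewrite !mxE.
congr (nat_of_bool _)%:R; have [] := curry_mxvec_bij 2 2 => dec decK _.
case: s t {eU} => [a b] [c d] /=; apply/eqP/eqP=> [|[-> ->]//] e.
by rewrite -[LHS]decK ?inE // -[RHS]decK ?inE //= e.
Qed.

Lemma gate_entry_unitary_adj g (s t : gate_index g) :
  \sum_r (gate_entry r s)^* * gate_entry r t = (s == t)%:R.
Proof.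
case: g s t => [i U uU|i j U ij uU] s t /=; have := uU; rewrite -trmxC_unitary.
all: move/unitarymxP/matrixP.
  move/(_ s t); rewrite !mxE => <-; apply: eq_bigr => r _; rewrite !mxE.
  by rewrite conjCK.
move/(_ (mxvec_index s.1 s.2) (mxvec_index t.1 t.2)); rewrite !mxE.
rewrite (reindex _ (curry_mxvec_bij _ _)) /= => eU.
transitivity ((mxvec_index s.1 s.2 == mxvec_index t.1 t.2)%:R : K).
  by rewrite -eU; apply: eq_bigr => -[a b] _; rewrite !mxE conjCK.
congr (nat_of_bool _)%:R; have [] := curry_mxvec_bij 2 2 => dec decK _.
case: s t {eU} => [a b] [c d] /=; apply/eqP/eqP=> [|[-> ->]//] e.
by rewrite -[LHS]decK ?inE // -[RHS]decK ?inE //= e.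
Qed.

Definition apply_gate_adj g psi : qvect R V :=
  [ffun x => \sum_t (gate_entry t (gate_read g x))^* * (psi (gate_write t x) : K)].

Lemma apply_gateK g : cancel (apply_gate g) (apply_gate_adj g).
Proof.
move=> psi; apply/ffunP=> x; rewrite ffunE.
under eq_bigr => t _ do rewrite apply_gateE gate_writeK big_distrr /=.
rewrite exchange_big /=.
under eq_bigr => s _.
  under eq_bigr => t _ do rewrite gate_write_write mulrA.
  rewrite -big_distrl /= gate_entry_unitary_adj; over.
rewrite (bigD1 (gate_read g x)) //= eqxx mul1r gate_readK big1 ?addr0 // => s.
by rewrite eq_sym => /negPf->; rewrite mul0r.
Qed.

Lemma apply_gate_adjK g : cancel (apply_gate_adj g) (apply_gate g).
Proof.
move=> psi; apply/ffunP=> x; rewrite apply_gateE.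
under eq_bigr => t _ do rewrite ffunE gate_writeK big_distrr /=.
rewrite exchange_big /=.
under eq_bigr => s _.
  under eq_bigr => t _ do rewrite gate_write_write mulrA.
  rewrite -big_distrl /= gate_entry_unitary; over.
rewrite (bigD1 (gate_read g x)) //= eqxx mul1r gate_readK big1 ?addr0 // => s.
by rewrite eq_sym => /negPf->; rewrite mul0r.
Qed.

Lemma apply_gateC g h psi : [disjoint gate_supp g & gate_supp h] ->
  apply_gate g (apply_gate h psi) = apply_gate h (apply_gate g psi).
Proof.
move=> dgh; have dhg : [disjoint gate_supp h & gate_supp g] by rewrite disjoint_sym.
apply/ffunP=> x; rewrite !apply_gateE.
under eq_bigr => s _ do rewrite apply_gateE big_distrr /=.
rewrite exchange_big /=; apply: eq_bigr => t _.
rewrite apply_gateE big_distrr /=; apply: eq_bigr => s _.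
by rewrite !gate_read_write // gate_writeC // mulrCA.
Qed.

Definition dotp (f1 f2 : qvect R V) : K := \sum_x (f1 x : K)^* * (f2 x : K).

Lemma dotp_gate g f1 f2 : dotp (apply_gate g f1) f2 = dotp f1 (apply_gate_adj g f2).
Proof.
rewrite /dotp.
under eq_bigr => x _ do rewrite apply_gateE rmorph_sum big_distrl /=.
under [RHS]eq_bigr => x _ do rewrite ffunE big_distrr /=.
rewrite !pair_bigA /=.
(* Exchanging the bits stored in [x] with the summation index [t] turns one double sum into the
   other. *)
pose swap (p : bitstring V * gate_index g) := (gate_write p.2 p.1, gate_read g p.1).
have swapK : involutive swap.
  by case=> x t; rewrite /swap /= gate_write_write gate_writeK gate_readK.
rewrite (reindex_inj (inv_inj swapK)); apply: eq_bigr => -[x t] _ /=.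
rewrite gate_writeK gate_write_write gate_readK rmorphM.
by rewrite mulrAC mulrC !mulrA.
Qed.

Lemma dotp_conj f1 f2 : (dotp f1 f2)^* = dotp f2 f1.
Proof.
rewrite /dotp rmorph_sum; apply: eq_bigr => x _.
by rewrite rmorphM /= conjCK mulrC.
Qed.

(** * Pulling observables back through a circuit, and their locality *)

Definition evolve gs psi : qvect R V := foldl (fun f g => apply_gate g f) psi gs.

Definition evolve_adj gs psi : qvect R V := foldr apply_gate_adj psi gs.

Definition circuit_gates C : seq (gate R V) := flatten (map (@layer_gates R V) C).

Lemma run_evolve C psi : run C psi = evolve (circuit_gates C) psi.
Proof.
rewrite /circuit_gates; elim: C psi => //= L C IH psi.
by rewrite /evolve foldl_cat -/(evolve _ _) -IH.
Qed.

Lemma evolveK gs : cancel (evolve gs) (evolve_adj gs).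
Proof.
by elim: gs => [|g gs IH] psi //=; rewrite [X in apply_gate_adj _ X]IH apply_gateK.
Qed.

Lemma evolve_adjK gs : cancel (evolve_adj gs) (evolve gs).
Proof. by elim: gs => [|g gs IH] psi //=; rewrite apply_gate_adjK; apply: IH. Qed.

Lemma dotp_evolve gs f1 f2 : dotp (evolve gs f1) f2 = dotp f1 (evolve_adj gs f2).
Proof. by elim: gs f1 => //= g gs IH f1; rewrite -dotp_gate; apply: IH. Qed.

(* The commutation encodes that A acts on the qubits of S only, without any tensor
   decomposition of the state space. *)
Definition local_on (S : {set V}) (A : qvect R V -> qvect R V) :=
  forall g, [disjoint gate_supp g & S] ->
  forall psi, A (apply_gate g psi) = apply_gate g (A psi).

Lemma apply_gate_adjC g h psi : [disjoint gate_supp g & gate_supp h] ->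
  apply_gate_adj g (apply_gate h psi) = apply_gate h (apply_gate_adj g psi).
Proof.
by move=> dgh; rewrite -{1}[psi](apply_gate_adjK g) -apply_gateC // apply_gateK.
Qed.

(** If [g] misses [S], it commutes with [A] and the conjugation does nothing. Otherwise a gate that
    misses both [S] and the support of [g] commutes with each of the three factors. *)
Lemma local_on_conj_gate (S : {set V}) A g : local_on S A ->
  local_on (if [disjoint gate_supp g & S] then S else gate_supp g :|: S)
    (fun psi => apply_gate_adj g (A (apply_gate g psi))).
Proof.
move=> locA h; case: ifPn => [dg|_] dh psi.
  by rewrite !locA // !apply_gateK.
have [dhg dhS] : [disjoint gate_supp h & gate_supp g] /\ [disjoint gate_supp h & S].
  by split; apply: disjointWr dh; rewrite ?subsetUl ?subsetUr.
by rewrite -apply_gateC // locA // apply_gate_adjC 1?disjoint_sym.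
Qed.

Lemma local_on_conj (S : {set V}) A gs : local_on S A ->
  local_on (gate_cone (map (@gate_supp R V) gs) S)
    (fun psi => evolve_adj gs (A (evolve gs psi))).
Proof. by move=> locA; elim: gs => //= g gs IH; apply: local_on_conj_gate IH. Qed.

(** The projector onto the strings with bit [i] equal to 1, so that its expectation is the
    probability of measuring 1 there. *)
Definition bit_proj i psi : qvect R V := [ffun x : bitstring V => (x i)%:R * (psi x : K)].

Lemma local_on_bit_proj i : local_on [set i] (bit_proj i).
Proof.
move=> g; rewrite disjoint_sym disjoints1 => gi psi; apply/ffunP=> x.
rewrite ffunE !apply_gateE big_distrr; apply: eq_bigr => t _ /=.
by rewrite ffunE gate_write_out // mulrCA.
Qed.

Definition pauliZ_mx : 'M[K]_2 := \matrix_(a, b) ((a == b)%:R * (-1) ^+ a).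

Lemma pauliZ_unitary : pauliZ_mx \is unitarymx.
Proof.
apply/unitarymxP/matrixP=> a b; rewrite !mxE (bigD1 a) //= big1 ?addr0 => [|c ca].
  rewrite !mxE eqxx mul1r eq_sym; case: eqP => [->|_]; last by rewrite mul0r conjC0 mulr0.
  by rewrite mul1r rmorphXn rmorphN1 -expr2 sqrr_sign.
by rewrite !mxE eq_sym (negPf ca) mul0r mul0r.
Qed.

Definition pauliZ v : gate R V := Gate1 v pauliZ_unitary.

Lemma pauliZE v psi x : apply_gate (pauliZ v) psi x = (-1) ^+ x v * (psi x : K).
Proof.
rewrite ffunE (bigD1 (x v)) //= big1 ?addr0 => [|a ax].
  rewrite mxE eqxx mul1r; congr (_ * psi _).
  by apply/ffunP=> u; rewrite ffunE; case: eqP => // ->.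
by rewrite mxE eq_sym (negPf ax) !mul0r.
Qed.

(** Pauli Z on [v] fixes the zero state and commutes with [A], hence fixes the image of that state;
    where bit [v] is 1, the amplitude then equals its own opposite. *)
Lemma local_on_ket0 (S : {set V}) A x v : local_on S A -> v \notin S -> x v != ord0 ->
  A (ket0 R V) x = 0.
Proof.
move=> locA vS xv.
have Z0 : apply_gate (pauliZ v) (ket0 R V) = ket0 R V.
  apply/ffunP=> y; rewrite pauliZE !ffunE.
  by case: eqP => [->|_]; rewrite ?ffunE ?mulr0 ?mul1r.
have := locA (pauliZ v); rewrite disjoints1 => /(_ vS (ket0 R V)).
rewrite Z0 => /ffunP/(_ x); rewrite pauliZE.
have -> : x v = 1 :> nat by case: (x v) xv => [[|[|]]].
rewrite expr1 mulN1r => /eqP; rewrite -addr_eq0 -mulr2n mulrn_eq0 /=.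
by move/eqP.
Qed.

Lemma dotp_ket0 f : dotp (ket0 R V) f = f [ffun=> ord0].
Proof.
rewrite /dotp (bigD1 [ffun=> ord0]) //= ffunE eqxx conjC1 mul1r big1 ?addr0 //.
by move=> x x0; rewrite ffunE (negPf x0) conjC0 mul0r.
Qed.

(** The two images of the zero state are supported on strings vanishing outside [S] and outside [T]
    respectively. Only the zero string is in both, so the inner product has a single term, the
    product of the two expectations. *)
Lemma dotp_local (S T : {set V}) A B : [disjoint S & T] -> local_on S A -> local_on T B ->
  dotp (A (ket0 R V)) (B (ket0 R V)) =
  dotp (A (ket0 R V)) (ket0 R V) * dotp (ket0 R V) (B (ket0 R V)).
Proof.
move=> dST locA locB; rewrite -(dotp_conj (ket0 R V)) !dotp_ket0.
rewrite {1}/dotp (bigD1 [ffun=> ord0]) //= big1 ?addr0 // => x x0.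
have [v xv] : exists v, x v != ord0.
  apply/existsP; apply: contraR x0; rewrite negb_exists => /forallP x0.
  by apply/eqP/ffunP=> v; rewrite ffunE; apply/eqP; rewrite -[_ == _]negbK x0.
have [Sv|Sv] := boolP (v \in S).
  by rewrite (local_on_ket0 locB (v := v)) ?mulr0 // (disjointFr dST).
by rewrite (local_on_ket0 locA (v := v)) ?conjC0 ?mul0r.
Qed.

Definition circuit_supports C : seq (seq {set V}) :=
  [seq map (@gate_supp R V) (layer_gates L) | L <- C].

Lemma circuit_supports_disjoint C :
  all (pairwise (@disjoint_sets V)) (circuit_supports C).
Proof.
rewrite all_map; elim: C => //= L C ->; rewrite andbT pairwise_map.
exact: layer_disjoint.
Qed.

Lemma uncorrelated_bits C i j :
  [disjoint backward_cone (circuit_supports C) [set i]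
          & backward_cone (circuit_supports C) [set j]] ->
  let psi := run C (ket0 R V) in
  dotp (bit_proj i psi) (bit_proj j psi) =
  dotp (bit_proj i psi) psi * dotp psi (bit_proj j psi).
Proof.
move=> dij psi; rewrite /psi run_evolve; set gs := circuit_gates C.
(* The inverse evolution is an isometry: it moves the circuit from the state onto the observables,
   leaving the zero state. *)
have conj_dotp f1 f2 : dotp f1 f2 = dotp (evolve_adj gs f1) (evolve_adj gs f2).
  by rewrite -dotp_evolve evolve_adjK.
rewrite (conj_dotp _ (bit_proj j _)) (conj_dotp _ (evolve _ _)).
rewrite [in X in _ * X]conj_dotp evolveK.
have sub v : gate_cone (map (@gate_supp R V) gs) [set v] \subset
             backward_cone (circuit_supports C) [set v].
  rewrite /gs /circuit_gates map_flatten -map_comp.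
  exact: gate_cone_backward (circuit_supports_disjoint C).
apply: dotp_local (local_on_conj (@local_on_bit_proj i))
  (local_on_conj (@local_on_bit_proj j)).
exact: disjointWl (sub i) (disjointWr (sub j) dij).
Qed.

End Circuits.

(** * Counting ones and pairs of ones in a Hamming slice *)

Section HammingSlice.

Variables (V : finType) (k : nat).
Implicit Types (i j : V) (x : bitstring V).

Definition slice_card := (\sum_(x : bitstring V | hweight x == k) 1)%N.
Definition slice_ones i := (\sum_(x : bitstring V | hweight x == k) x i)%N.
Definition slice_pairs i j := (\sum_(x : bitstring V | hweight x == k) x i * x j)%N.

Definition permute_bits (s : {perm V}) x : bitstring V := [ffun v => x (s v)].

Lemma sum_slice_permute (s : {perm V}) (F : bitstring V -> nat) :
  (\sum_(x : bitstring V | hweight x == k) F x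
   = \sum_(x : bitstring V | hweight x == k) F (permute_bits s x))%N.
Proof.
have inj_s : injective (permute_bits s).
  move=> x y /ffunP exy; apply/ffunP=> v.
  by have := exy (s^-1%g v); rewrite !ffunE permKV.
rewrite (reindex_inj inj_s); apply: eq_bigl => x.
congr (_ == _); rewrite /hweight [RHS](reindex_inj (@perm_inj _ s)) /=.
by apply: eq_bigr => v _; rewrite ffunE.
Qed.

(** Transpositions preserve the slice, so all positions carry equally many ones; then the ones of
    the slice are counted by position and by string. *)
Lemma slice_ones_mul i : (#|V| * slice_ones i = k * slice_card)%N.
Proof.
rewrite -sum_nat_const.
transitivity (\sum_j slice_ones j)%N.
  apply: eq_bigr => j _; rewrite /slice_ones (sum_slice_permute (tperm i j)).
  by apply: eq_bigr => x _; rewrite ffunE tpermL.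
rewrite /slice_ones exchange_big /slice_card big_distrr /=.
by apply: eq_bigr => x /eqP; rewrite muln1.
Qed.

(** The same double count with [i] fixed: a string having bit [i] equal to 1 has [k.-1] ones
    elsewhere. The transposition used moves [j] and fixes [i]. *)
Lemma slice_pairs_mul i j : i != j ->
  (#|V|.-1 * slice_pairs i j = k.-1 * slice_ones i)%N.
Proof.
move=> ij; rewrite -(cardC1 i) -sum_nat_const.
transitivity (\sum_(l | l != i) slice_pairs i l)%N.
  apply: eq_bigr => l li; rewrite /slice_pairs (sum_slice_permute (tperm j l)).
  by apply: eq_bigr => x _; rewrite !ffunE tpermL tpermD // eq_sym.
rewrite /slice_pairs exchange_big /slice_ones big_distrr /=.
apply: eq_bigr => x /eqP <-; rewrite -big_distrr /= mulnC /hweight [in RHS](bigD1 i) //=.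
by case: (x i) => [[|[|]]] //= _; rewrite ?muln0 ?muln1.
Qed.

Lemma slice_correlated i j : i != j -> (0 < k < #|V|)%N -> (0 < slice_card)%N ->
  (slice_pairs i j * slice_card != slice_ones i * slice_ones j)%N.
Proof.
move=> ij /andP[k0 kV] N0; apply/eqP=> e.
have := slice_ones_mul i; have := slice_ones_mul j; have := slice_pairs_mul ij.
move: e kV N0 k0; move: (slice_pairs i j) (slice_ones i) (slice_ones j) slice_card #|V|.
move=> P a b N n e kn N0 k0 eP eb ea.
have a0 : (0 < a)%N by case: a ea {e eP} => //; nia.
have eab : a = b by apply/eqP; rewrite -(eqn_pmul2l (m := n)) ?ea ?eb //; lia.
(* Cancelling [a * N] will leave [(n - 1) k = (k - 1) n], that is [k = n], against [k < n]. *)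
have : (a * N * (n.-1 * k) = a * N * (k.-1 * n))%N.
  transitivity (n.-1 * (a * (n * b)))%N; first by rewrite eb; ring.
  transitivity (n * (n.-1 * (P * N)))%N; first by rewrite e; ring.
  by rewrite [(n.-1 * _)%N]mulnA eP; ring.
move/eqP; rewrite eqn_pmul2l ?muln_gt0 ?a0 // => /eqP.
by case: n k kn k0 {e eP ea eb} => [|n] [|k'] //=; nia.
Qed.

End HammingSlice.

(** * Circuits that generate Dicke states *)

Section DickeCircuits.

Variables (R : realType) (V : finType).

Lemma dickeE k x :
  dicke R V k x = (sqrtC ('C(#|V|, k)%:R : R[i]))^-1 * (hweight x == k)%:R.
Proof.
rewrite ffunE sum_ffunE; congr (_ * _); rewrite (eq_bigr (fun y => (x == y)%:R : R[i])).
  have [wx|wx] := boolP (hweight x == k).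
    rewrite (bigD1 x) //= eqxx big1 ?addr0 // => y /andP[_].
    by rewrite eq_sym => /negPf->.
  rewrite big1 // => y wy; case: eqP => // xy; by rewrite xy wy in wx.
by move=> y _; rewrite ffunE.
Qed.

Lemma dicke_light_cones_meet k (C : circuit R V) i j :
  generates_dicke C k -> (0 < k < #|V|)%N -> i != j ->
  ~~ [disjoint backward_cone (circuit_supports C) [set i]
             & backward_cone (circuit_supports C) [set j]].
Proof.
move=> genC kV ij; apply/negP=> /uncorrelated_bits /=.
(* Unitarity gives the Dicke state norm 1. This is the only normalisation needed, so the slice is
   never identified with a binomial coefficient. *)
have := dotp_evolve (circuit_gates C) (ket0 R V) (run C (ket0 R V)).
rewrite -run_evolve {3}run_evolve evolveK dotp_ket0 ffunE eqxx genC.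
set z := (sqrtC ('C(#|V|, k)%:R : R[i]))^-1.
(* All four inner products involve diagonal weights times the Dicke state, so each is the common
   factor [z^* * z] times a count over the slice. *)
have dotE (F1 F2 : bitstring V -> nat) (f1 f2 : qvect R V) :
    (forall x, f1 x = (F1 x)%:R * dicke R V k x) ->
    (forall x, f2 x = (F2 x)%:R * dicke R V k x) ->
  dotp f1 f2 = (z^* * z) *
     (\sum_(x : bitstring V | hweight x == k) F1 x * F2 x)%N%:R.
  move=> e1 e2; rewrite natr_sum big_distrr [RHS]big_mkcond /=.
  apply: eq_bigr => x _; rewrite e1 e2 dickeE -/z.
  case: ifP => _; last by rewrite !mulr0.
  rewrite !mulr1.
  rewrite rmorphM /= conjC_nat natrM; ring.
have e0 x : dicke R V k x = 1%:R * dicke R V k x by rewrite mul1r.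
have e1 v x : bit_proj v (dicke R V k) x = (x v)%:R * dicke R V k x by rewrite ffunE.
set c := z^* * z in dotE; set D := dicke R V k in e0 e1 dotE *.
have -> : dotp D D = c * (slice_card V k)%:R by rewrite (dotE _ _ _ _ e0 e0).
have -> : dotp (bit_proj i D) D = c * (slice_ones k i)%:R.
  rewrite (dotE _ _ _ _ (e1 i) e0); congr (_ * _%:R).
  by apply: eq_bigr => x _; rewrite muln1.
have -> : dotp D (bit_proj j D) = c * (slice_ones k j)%:R.
  rewrite (dotE _ _ _ _ e0 (e1 j)); congr (_ * _%:R).
  by apply: eq_bigr => x _; rewrite mul1n.
have -> : dotp (bit_proj i D) (bit_proj j D) = c * (slice_pairs k i j)%:R.
  by rewrite (dotE _ _ _ _ (e1 i) (e1 j)).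
move=> cN /eqP; apply/negP.
have c0 : c != 0 by apply: contra_eq_neq cN => ->; rewrite mul0r eq_sym oner_eq0.
have N0 : (0 < slice_card V k)%N.
  by rewrite lt0n; apply: contra_eq_neq cN => ->; rewrite mulr0 eq_sym oner_eq0.
have := slice_correlated ij kV N0; apply: contra => /eqP e.
(* Multiplying the factorisation by [c * N = 1], with [N] the slice size, makes both sides
   homogeneous of degree 2 in [c]. *)
have : c ^+ 2 * ((slice_pairs k i j * slice_card V k)%N%:R
                 - (slice_ones k i * slice_ones k j)%N%:R) = 0.
  rewrite mulrBr expr2 !natrM.
  transitivity (c * (slice_pairs k i j)%:R * (c * (slice_card V k)%:R)
    - c * (slice_ones k i)%:R * (c * (slice_ones k j)%:R)); first by ring.
  by rewrite cN mulr1 e subrr.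
by move/eqP; rewrite mulf_eq0 expf_eq0 (negPf c0) /= subr_eq0 eqr_nat.
Qed.

Lemma circuit_supports_two_local (C : circuit R V) :
  all (@two_local_layer V) (circuit_supports C).
Proof.
elim: C => //= L C ->; rewrite andbT /two_local_layer pairwise_map layer_disjoint.
by rewrite all_map; elim: (layer_gates L) => //= -[i U uU|i j U ij uU] gs ->;
  rewrite /= ?cards1 ?cards2 ?ij.
Qed.

Lemma circuit_supports_dist (G : sgraph V) (phi : V -> nat) (C : circuit R V) :
  (forall u v, edge G u v -> phi u <= (phi v).+1)%N -> under_constraint G C ->
  all (all (fun T : {set V} =>
    [forall v in T, [forall w in T, phi v <= (phi w).+1]]))%N (circuit_supports C).
Proof.
move=> phiG; elim: C => //= L C IH /andP[GL /IH->]; rewrite andbT all_map.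
elim: (layer_gates L) GL => //= g gs IHg /andP[Gg /IHg->]; rewrite andbT.
case: g Gg => [i U uU|i j U ij uU] /= Gg; apply/forall_inP => v +;
  rewrite !inE => vi; apply/forall_inP => w; rewrite !inE.
  by move: vi => /eqP-> /eqP->.
move: vi => /orP[] /eqP-> /orP[] /eqP-> //; apply: phiG => //.
by rewrite edge_sym.
Qed.

Lemma dicke_depth_log k (C : circuit R V) :
  generates_dicke C k -> (0 < k < #|V|)%N -> (#|V| <= 4 ^ depth C)%N.
Proof.
move=> genC kV; have [i _] : exists i : V, i \in V.
  by apply/card_gt0P; case/andP: kV; apply: ltn_trans.
rewrite /depth -(size_map (fun L => map (@gate_supp R V) (layer_gates L)) C).
apply: (@card_meeting_cones _ _ i (circuit_supports_two_local C)) => j ji.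
by apply: dicke_light_cones_meet genC kV _; rewrite eq_sym.
Qed.

(** The cones of [i] and [j] share a vertex, whose potential is within [depth C] of both [phi i] and
    [phi j]. *)
Lemma dicke_depth_dist (G : sgraph V) (phi : V -> nat) k (C : circuit R V) i j :
  (forall u v, edge G u v -> phi u <= (phi v).+1)%N -> under_constraint G C ->
  generates_dicke C k -> (0 < k < #|V|)%N ->
  (phi j <= phi i + (depth C).*2)%N.
Proof.
move=> phiG GC genC kV; have [->|ij] := eqVneq i j; first exact: leq_addr.
rewrite /depth -(size_map (fun L => map (@gate_supp R V) (layer_gates L)) C).
apply: meeting_cones_dist (circuit_supports_dist phiG GC) _.
exact: dicke_light_cones_meet genC kV ij.
Qed.

End DickeCircuits.

(** * Depth bounds for the three connectivity graphs *)

Lemma adjacent_ord_leS n (u v : 'I_n) : adjacent_ord u v -> (u <= v.+1)%N.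
Proof. by rewrite /adjacent_ord => /orP[] /eqP <-; lia. Qed.

Theorem theorem20 (R : realType) :
  [/\ exists2 c : R, 0 < c &
        forall (n k : nat) (C : circuit R 'I_n),
          (1 <= k <= n./2)%N ->
          under_constraint (complete_graph 'I_n) C ->
          generates_dicke C k ->
          c * ln n%:R <= (depth C)%:R,
      exists2 c : R, 0 < c &
        forall (n n1 n2 k : nat) (C : circuit R ('I_n1 * 'I_n2)%type),
          (1 <= k <= n./2)%N ->
          (0 < n1)%N -> (n1 <= n2)%N -> n = (n1 * n2)%N ->
          under_constraint (grid_graph n1 n2) C ->
          generates_dicke C k ->
          c * n2%:R <= (depth C)%:R
    & exists2 c : R, 0 < c &
        forall (n k : nat) (C : circuit R 'I_n),
          (1 <= k <= n./2)%N ->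
          under_constraint (path_graph n) C ->
          generates_dicke C k ->
          c * n%:R <= (depth C)%:R].
Proof.
have k_range n k : (1 <= k <= n./2)%N -> (0 < k < n)%N by lia.
split.
- have ln4 : 0 < ln (4 : R) by rewrite ln_gt0 // ltr1n.
  (* The constant comes from taking logarithms in [n <= 4 ^ depth C]. *)
  exists (ln (4 : R))^-1; rewrite ?invr_gt0 // => n k C /k_range kn _ genC.
  rewrite ler_pdivrMl // mulr_natr -lnXn ?ltr0n //.
  rewrite ler_ln ?posrE ?exprn_gt0 ?ltr0n -?natrX ?ler_nat //; last by lia.
  by rewrite -[n in (n <= _)%N]card_ord (dicke_depth_log genC) ?card_ord.
- exists (4^-1 : R); rewrite ?invr_gt0 ?ltr0n // => n n1 n2 k C /k_range kn.
  move=> n1_gt0 n12 en GC genC.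
  case: n1 n2 n1_gt0 n12 en C GC genC => [//|n1] [|n2] // _ n12 en C GC genC.
  have kV : (0 < k < #|{: 'I_n1.+1 * 'I_n2.+1}|)%N by rewrite card_prod !card_ord -en.
  (* There are at least two columns, since [n1 <= n2] and [n >= 2]. This forces depth at least 1, so
     with m columns the bound [m - 1 <= 2d] gives [m <= 2d + 1 <= 4d], whence the constant 1/4. *)
  have n2_gt0 : (0 < n2)%N by case: n2 n12 en {C GC genC kV} => //; nia.
  (* The column index changes by at most 1 along a grid edge, and is compared at the two ends of the
     first row. *)
  pose phi (u : 'I_n1.+1 * 'I_n2.+1) := nat_of_ord u.2.
  have col u v : edge (grid_graph n1.+1 n2.+1) u v -> (phi u <= (phi v).+1)%N.
    by case/orP=> /andP[/eqP e /adjacent_ord_leS]; rewrite /phi ?e.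
  have := dicke_depth_dist (ord0, ord0) (ord0, ord_max) col GC genC kV.
  rewrite /phi /= => h.
  rewrite mulrC ler_pdivrMr ?ltr0n // -natrM ler_nat.
  by move: (depth C) n2_gt0 h; clear => d; lia.
- exists (4^-1 : R); rewrite ?invr_gt0 ?ltr0n // => n k C /k_range kn GC genC.
  case: n C kn GC genC => [|n] C kn GC genC; first by lia.
  have kV : (0 < k < #|'I_n.+1|)%N by rewrite card_ord.
  (* On the path the position itself is the potential, compared at the two endpoints; 1/4 again
     absorbs the off-by-one, as there are at least two vertices. *)
  have := dicke_depth_dist (G := path_graph n.+1) (phi := @nat_of_ord n.+1)
    ord0 ord_max (@adjacent_ord_leS n.+1) GC genC kV.
  rewrite /= => h; rewrite mulrC ler_pdivrMr ?ltr0n // -natrM ler_nat.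
  by move: (depth C) kn h; clear => d; lia.
Qed.
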